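(* For every nonzero $f\in\ell^2(V,w)$ and every integer $1\le k\le n$ with $\alpha_k>0$, $$\beta(f)\le16\sqrt2\,k\,\frac{\mathcal R^+(f)}{\sqrt{\alpha_k}}.$$ In particular (taking $f$ an eigenvector for $\alpha_1$), $\beta(G)\le 16\sqrt2\,k\,\alpha_1/\sqrt{\alpha_k}$.
   Context: $G=(V,E,w)$ finite undirected, positive edge weights, $n=|V|$, $w(v)=\sum_{u\sim v}w(u,v)\ge1$, $\mathrm{vol}(S)=\sum_{v\in S}w(v)$; $w(E(S))$ is the weight of edges with both endpoints in $S$, $w(E(S,T))$ the weight of edges between disjoint $S,T$. For disjoint $L,R\subseteq V$ with $L\cup R\ne\emptyset$, the bipartiteness ratio is $\beta(L,R)=\frac{2w(E(L))+2w(E(R))+w(E(L\cup R,V\setminus(L\cup R)))}{\mathrm{vol}(L\cup R)}$, and $\beta(G)=\min\beta(L,R)$. For $f\in\mathbb R^V$ and $t>0$, $L_f(t)=\{v:f(v)\le-t\}$, $R_f(t)=\{v:f(v)\ge t\}$, and $\beta(f)=\min\{\beta(L_f(t),R_f(t)):t>0,\ L_f(t)\cup R_f(t)\ne\emptyset\}$. $\mathcal R^+(f)=\sum_{\{u,v\}\in E}w(u,v)(f(u)+f(v))^2/\sum_vw(v)f(v)^2$. $\alpha_1\le\dots\le\alpha_n$ are the eigenvalues of $\mathcal M=I+D^{-1/2}AD^{-1/2}$ ($A$ weighted adjacency matrix, $D$ diagonal degree matrix). *)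

(* Defs.v *)
(* Vertices are 'I_n; weights w : 'I_n -> 'I_n -> R over a
   real closed field R (needed for square roots). *)
From HB Require Import structures.
From mathcomp Require Import all_boot all_order all_algebra.
Set Implicit Arguments. Unset Strict Implicit. Unset Printing Implicit Defensive.
Import Order.TTheory GRing.Theory Num.Theory.
Local Open Scope ring_scope.

Section Graph.
Variables (R : rcfType) (n : nat) (w : 'I_n -> 'I_n -> R).

(* finite undirected weighted graph without loops; u ~ v iff w u v > 0 *)
Definition is_weighted_graph : Prop :=
  (forall u v, w u v = w v u) /\ (forall u v, 0 <= w u v) /\ (forall u, w u u = 0).

Definition deg (v : 'I_n) : R := \sum_(u < n) w u v.

Definition vol (S : {set 'I_n}) : R := \sum_(v in S) deg v.

(* w(E(S)): each unordered edge counted once *)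
Definition wE (S : {set 'I_n}) : R := (\sum_(u in S) \sum_(v in S) w u v) / 2%:R.

(* w(E(S,T)) for disjoint S,T *)
Definition wE2 (S T : {set 'I_n}) : R := \sum_(u in S) \sum_(v in T) w u v.

Definition bip_ratio (L Rs : {set 'I_n}) : R :=
  (2%:R * wE L + 2%:R * wE Rs + wE2 (L :|: Rs) (~: (L :|: Rs))) / vol (L :|: Rs).

Definition is_betaG (b : R) : Prop :=
  (exists L Rs : {set 'I_n}, [disjoint L & Rs] /\ L :|: Rs != set0 /\ bip_ratio L Rs = b) /\
  (forall L Rs : {set 'I_n}, [disjoint L & Rs] -> L :|: Rs != set0 -> b <= bip_ratio L Rs).

Definition Lf (f : 'I_n -> R) (t : R) : {set 'I_n} := [set v | f v <= - t].
Definition Rf (f : 'I_n -> R) (t : R) : {set 'I_n} := [set v | t <= f v].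

Definition is_beta_f (f : 'I_n -> R) (b : R) : Prop :=
  (exists t, 0 < t /\ Lf f t :|: Rf f t != set0 /\ bip_ratio (Lf f t) (Rf f t) = b) /\
  (forall t, 0 < t -> Lf f t :|: Rf f t != set0 -> b <= bip_ratio (Lf f t) (Rf f t)).

(* R^+(f): sum over unordered edges {u,v} = half the sum over ordered pairs *)
Definition RayleighPlus (f : 'I_n -> R) : R :=
  ((\sum_(u < n) \sum_(v < n) w u v * (f u + f v) ^+ 2) / 2%:R)
  / (\sum_(v < n) deg v * f v ^+ 2).

Definition adjA : 'M[R]_n := \matrix_(i, j) w i j.
Definition Dmhalf : 'M[R]_n := diag_mx (\row_i (Num.sqrt (deg i))^-1).
Definition Mmat : 'M[R]_n := 1%:M + Dmhalf *m adjA *m Dmhalf.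

Definition is_sorted_spectrum (s : seq R) : Prop :=
  size s = n /\ sorted <=%R s /\ char_poly Mmat = \prod_(a <- s) ('X - a%:P).

End Graph.

(* Main.v *)
(* Bipartite version of the improved Cheeger inequality of Kwok, Lau, Lee, Oveis
   Gharan and Trevisan. Thresholds 0 = t_0 <= t_1 <= ... are chosen greedily so
   that the tent functions of |f| over the intervals [t_i, t_(i+1)] all have the
   same mass C. Signed like f, these tents have disjoint supports and their
   energies add up to at most that of f. If 2k of them were needed, k of them
   would have energy so small that, by Courant-Fischer, C would be too small;
   hence 2k intervals exhaust |f|. Let d be the distance to the nearest threshold
   and H its integral. Sampling the cut level with density d (a coarea argument
   applied to H(|f|)) bounds beta(f) by the ratio of an l^1 energy of H(|f|), at
   most a combination of the energy of f and of the mass of d(|f|), to the mass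
   of H(|f|), which is at least norm(f)^2 / (8 k). Balancing the two energy terms
   gives the bound. *)
Require Import Defs.
From HB Require Import structures.
From mathcomp Require Import all_boot all_order all_algebra.
From mathcomp Require Import ring lra.
Set Implicit Arguments.
Unset Strict Implicit.
Import Order.TTheory GRing.Theory Num.Theory.
Local Open Scope ring_scope.

(** * Diagonalization of symmetric matrices and the variational principle *)

Section SymmetricMatrices.
Variable R : rcfType.

Lemma mulmx_tr_eq0 m n (N : 'M[R]_(m, n)) : N *m N^T = 0 -> N = 0.
Proof.
move=> N0; apply/matrixP=> i j; rewrite mxE.
have /matrixP/(_ i i) := N0; rewrite !mxE => /eqP.
rewrite psumr_eq0 => [|l _]; last by rewrite mxE -expr2 sqr_ge0.
by move=> /allP/(_ j (mem_index_enum j)); rewrite mxE mulf_eq0 orbb => /eqP.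
Qed.

(** Squares of symmetric matrices are symmetric, so the exponent can be halved repeatedly until
    [N *m N^T = 0] remains, where the diagonal entries are sums of squares. *)
Lemma sym_nilpotent_eq0 n (N : 'M[R]_n.+1) j :
  N^T = N -> N ^+ (2 ^ j) = 0 -> N = 0.
Proof.
elim: j N => [|j IH] N sN; first by rewrite expr1.
rewrite expnS exprM => /IH N2; apply: mulmx_tr_eq0; rewrite sN -[LHS]expr2.
by apply: N2; rewrite expr2 -[N * N]/(N *m N) trmx_mul sN.
Qed.

Lemma horner_mx_tr n (A : 'M[R]_n.+1) p :
  A^T = A -> (horner_mx A p)^T = horner_mx A p.
Proof.
move=> sA; elim/poly_ind: p => [|p c IH]; first by rewrite rmorph0 trmx0.
rewrite rmorphD rmorphM /= horner_mx_X horner_mx_C linearD /= tr_scalar_mx.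
rewrite -[X in X^T]/(horner_mx A p *m A) trmx_mul IH sA.
by congr (_ + _); apply: comm_mx_horner.
Qed.

(** No root occurs more than [size s] times, so the [m]-th power of the squarefree part covers every
    multiplicity. The induction gives one factor of the power to each element of [s]. *)
Lemma dvdp_prod_XsubC_undup_exp (s : seq R) m : (size s <= m)%N ->
  \prod_(a <- s) ('X - a%:P) %| (\prod_(a <- undup s) ('X - a%:P)) ^+ m.
Proof.
elim: m s => [|m IH] s; first by rewrite leqn0 => /nilP->; rewrite big_nil expr0 dvdp1 size_poly1.
case: (lastP s) => [|s' a]; first by rewrite big_nil dvd1p.
rewrite size_rcons ltnS => sm.
have uq : \prod_(b <- undup s') ('X - b%:P) %| \prod_(b <- undup (rcons s' a)) ('X - b%:P).
  set p := \prod_(b <- undup (rcons s' a)) _.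
  have rp : all (root p) (undup s').
    by apply/allP=> x; rewrite root_prod_XsubC !mem_undup mem_rcons inE orbC => ->.
  have [|q ->] := uniq_roots_prod_XsubC rp; last exact: dvdp_mull.
  by rewrite uniq_rootsE undup_uniq.
rewrite -cats1 big_cat big_seq1 exprSr /= cats1; apply: dvdp_mul.
  by apply: dvdp_trans (IH _ sm) _; apply: dvdp_exp2r.
by rewrite dvdp_XsubCl root_prod_XsubC mem_undup mem_rcons mem_head.
Qed.

(** Let [q] have each eigenvalue as a simple root. A power of [q] is a multiple of the
    characteristic polynomial, so [q] evaluated at [A] is nilpotent by Cayley-Hamilton; being
    symmetric, it is zero. Hence the minimal polynomial has simple roots only. *)
Lemma sym_diagonalizable n (A : 'M[R]_n.+1) (s : seq R) : A^T = A ->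
  char_poly A = \prod_(a <- s) ('X - a%:P) ->
  exists2 P, P \in unitmx & exists d, P *m A = diag_mx d *m P.
Proof.
move=> sA cA; set q := \prod_(a <- undup s) ('X - a%:P).
have qA0 : horner_mx A q = 0.
  apply: (@sym_nilpotent_eq0 _ _ (size s)); first exact: horner_mx_tr.
  have /dvdpP[r e] := dvdp_prod_XsubC_undup_exp (ltnW (ltn_expl (size s) (isT : 1 < 2)%N)).
  by rewrite -rmorphXn /= e rmorphM /= -cA Cayley_Hamilton mulr0.
have dvdq : mxminpoly A %| q by exact: mxminpoly_min.
have /diagonalizableP[P Pu Pd] : exists2 rs, uniq rs & mxminpoly A %| \prod_(x <- rs) ('X - x%:P).
  by exists (undup s); first exact: undup_uniq.
exists P => //; move: Pd; rewrite /similar_to /= /conjmx pinvmxE // => /is_diag_mxP Pd.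
exists (\row_i (P *m A *m invmx P) i i).
rewrite -[LHS](mulmxKV Pu); congr (_ *m _); apply/matrixP=> i j.
rewrite [RHS]mxE [in RHS]mxE; case: eqP => [->|/eqP ij]; first by rewrite mulr1n.
by rewrite Pd // mulr0n.
Qed.

Lemma char_poly_similar_diag n (A P : 'M[R]_n) d : P \in unitmx ->
  P *m A = diag_mx d *m P -> char_poly A = \prod_i ('X - (d 0 i)%:P).
Proof.
move=> Pu PA; have -> : \prod_i ('X - (d 0 i)%:P) = char_poly (diag_mx d).
  by rewrite char_poly_trig ?diag_mx_is_trig //; apply: eq_bigr => i _; rewrite mxE eqxx mulr1n.
have P0 : \det (map_mx polyC P) != 0.
  by rewrite -[map_mx _ P]/(map_mx _ P) det_map_mx polyC_eq0 -unitfE.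
apply: (mulfI P0); rewrite /char_poly -det_mulmx [RHS]mulrC -det_mulmx.
congr (\det _); rewrite /char_poly_mx mulmxBr mulmxBl -!map_mxM PA.
by rewrite scalar_mxC.
Qed.

(* Courant-Fischer, only the half used here. *)
Lemma sym_minmax n (A : 'M[R]_n) (s : seq R) k (W : 'M[R]_(k, n)) : A^T = A ->
  size s = n -> sorted <=%R s -> char_poly A = \prod_(a <- s) ('X - a%:P) ->
  (0 < k <= n)%N -> row_free W ->
  exists2 y : 'rV_k, y != 0 &
    s`_k.-1 * (y *m W *m (y *m W)^T) 0 0 <= (y *m W *m A *m (y *m W)^T) 0 0.
Proof.
case: n A W => [|n] A W sA ss so cA; first by case: k W.
move=> /andP[k0 kn] fW.
have [P Pu [d PA]] := sym_diagonalizable sA cA.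
set al := s`_k.-1.
pose S := [set i | d 0 i < al].
have pds : perm_eq [seq d 0 i | i <- enum 'I_n.+1] s.
  by apply: prod_XsubC_eq; rewrite -cA (char_poly_similar_diag Pu PA) big_map big_enum.
(* By sortedness, entries of [s] below [al] can only sit at the first [k.-1] positions. *)
have cS : (#|S| < k)%N.
  have -> : #|S| = count (fun a => a < al) s.
    rewrite -(permP pds) count_map enumT cardE size_filter.
    by apply: eq_count => i; rewrite !inE.
  rewrite -(cat_take_drop k.-1 s) count_cat.
  have -> : count (fun a => a < al) (drop k.-1 s) = 0%N.
    apply/eqP; rewrite -leqn0 leqNgt -has_count; apply/hasPn => x /(nthP 0)[j].
    rewrite size_drop nth_drop ltn_subRL ss -leNgt => jn <-.
    by apply: (sorted_leq_nth le_trans le_refl) => //; 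
      rewrite ?inE ?leq_addr // ss // (leq_ltn_trans _ jn) ?leq_addr.
  rewrite addn0 (leq_ltn_trans (count_size _ _)) // size_take ss.
  by case: k k0 kn {W fW al S} => // k _ /= kn; rewrite kn.
(* [y *m U] lists the coordinates of [y *m W], in the basis of the rows of [P], at the indices in
   [S]. With more rows than columns, [U] has a nonzero left kernel. *)
pose U : 'M[R]_(k, #|S|) := colsub enum_val (W *m invmx P).
have [y yU y0] : exists2 y : 'rV_k, (y <= kermx U)%MS & y != 0.
  apply/rowV0Pn; rewrite kermx_eq0 /row_free neq_ltn.
  by rewrite (leq_ltn_trans (rank_leq_col U)).
exists y => //.
set x := y *m W; pose c := x *m invmx P.
have xc : x = c *m P by rewrite mulmxKV.
have c0 i : i \in S -> c 0 i = 0.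
  move=> iS; have /sub_kermxP/matrixP/(_ 0 (enum_rank_in iS i)) := yU.
  by rewrite /U mulmx_colsub mulmxA mxE enum_rankK_in // => ->; rewrite mxE.
(* The rows of [P] need not be orthonormal, so the forms are written through their Gram matrix; the
   symmetry of [A] makes rows for distinct eigenvalues orthogonal ([dG]). *)
pose G := P *m P^T.
have sG i j : G i j = G j i.
  by have : G^T = G by [rewrite trmx_mul trmxK]; move/matrixP/(_ j i); rewrite mxE.
have dG i j : d 0 i * G i j = d 0 j * G i j.
  have /matrixP/(_ i j) : (diag_mx d *m G)^T = diag_mx d *m G.
    by rewrite mulmxA -PA !trmx_mul trmxK sA mulmxA.
  by rewrite mxE mul_diag_mx [LHS]mxE [RHS]mxE => <-; rewrite sG.
have form (u v : 'rV_n.+1) (B : 'M[R]_n.+1) : (u *m B *m v^T) 0 0 = \sum_i \sum_j v 0 i * u 0 j * B j i.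
  rewrite mxE; apply: eq_bigr => i _; rewrite mxE mulr_suml.
  by apply: eq_bigr => j _; rewrite mxE; ring.
(* The difference of the two forms will be the squared length of [e *m P]. Where the root is taken
   of a negative number, [i] lies in [S] and [c 0 i] is zero. *)
pose e : 'rV_n.+1 := \row_i (c 0 i * Num.sqrt (d 0 i - al)).
have e0 : 0 <= (e *m G *m e^T) 0 0.
  rewrite /G mulmxA -mulmxA -trmx_mul mxE sumr_ge0 // => i _.
  by rewrite [X in _ * X]mxE -expr2 sqr_ge0.
rewrite -subr_ge0 [X in 0 <= X](_ : _ = (e *m G *m e^T) 0 0) //.
have -> : x *m A *m x^T = c *m (diag_mx d *m G) *m c^T.
  by rewrite xc trmx_mul /G !mulmxA -(mulmxA c P A) PA !mulmxA.
have -> : x *m x^T = c *m G *m c^T by rewrite xc trmx_mul /G !mulmxA.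
clearbody c G; rewrite !form mulr_sumr -sumrB; apply: eq_bigr => i _.
rewrite mulr_sumr -sumrB; apply: eq_bigr => j _.
rewrite !mul_diag_mx !mxE.
have [iS|iS] := boolP (i \in S); first by rewrite c0 //; ring.
have [jS|jS] := boolP (j \in S); first by rewrite (c0 j) //; ring.
have [->|Gn0] := eqVneq (G j i) 0; first by ring.
(* A nonzero Gram entry forces equal eigenvalues, so the two square roots multiply to
   [d 0 i - al]. *)
have dij : d 0 j = d 0 i by apply: (mulIf Gn0); rewrite dG.
have := sqr_sqrtr (_ : 0 <= d 0 i - al); rewrite dij.
rewrite inE -leNgt in iS; rewrite subr_ge0 => /(_ iS) sq.
transitivity (c 0 i * c 0 j * (d 0 i - al) * G j i); first by ring.
by rewrite -{1}sq; ring.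
Qed.
End SymmetricMatrices.

(** * The numerator and denominator of the Rayleigh quotient as quadratic forms *)

Section Energy.
Variables (R : rcfType) (n : nat) (w : 'I_n -> 'I_n -> R).

Definition energy (h : 'I_n -> R) : R :=
  (\sum_(u < n) \sum_(v < n) w u v * (h u + h v) ^+ 2) / 2%:R.

Definition norm2 (h : 'I_n -> R) : R := \sum_(v < n) deg w v * h v ^+ 2.

Hypothesis hw : is_weighted_graph w.
Hypothesis hdeg : forall v, 1 <= deg w v.

Lemma weight_ge0 u v : 0 <= w u v. Proof. by case: hw => _ []. Qed.
Lemma deg_gt0 v : 0 < deg w v. Proof. exact: lt_le_trans (hdeg v). Qed.

Lemma sum_weight_l (phi : 'I_n -> R) :
  \sum_u \sum_v w u v * phi u = \sum_u deg w u * phi u.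
Proof.
case: hw => sw _; apply: eq_bigr => u _; rewrite -mulr_suml.
by congr (_ * _); apply: eq_bigr => v _; rewrite sw.
Qed.

Lemma sum_weight_r (phi : 'I_n -> R) :
  \sum_u \sum_v w u v * phi v = \sum_u deg w u * phi u.
Proof. by rewrite exchange_big; apply: eq_bigr => u _; rewrite -mulr_suml. Qed.

Lemma energy_ge0 h : 0 <= energy h.
Proof.
rewrite divr_ge0 // sumr_ge0 // => u _; rewrite sumr_ge0 // => v _.
by rewrite mulr_ge0 ?weight_ge0 ?sqr_ge0.
Qed.

Lemma norm2_ge0 h : 0 <= norm2 h.
Proof. by rewrite sumr_ge0 // => u _; rewrite mulr_ge0 ?sqr_ge0 // ltW ?deg_gt0. Qed.

Lemma norm2_gt0 h : (exists v, h v != 0) -> 0 < norm2 h.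
Proof.
case=> v hv; rewrite lt_neqAle norm2_ge0 andbT eq_sym; apply/eqP => /eqP.
rewrite psumr_eq0 => [|u _]; last by rewrite mulr_ge0 ?sqr_ge0 // ltW ?deg_gt0.
move=> /allP/(_ v (mem_index_enum v)).
by rewrite mulf_eq0 sqrf_eq0 (negPf hv) gt_eqF ?deg_gt0.
Qed.

Lemma energyE h : energy h = norm2 h + \sum_u \sum_v w u v * (h u * h v).
Proof.
rewrite /energy; have -> : \sum_u \sum_v w u v * (h u + h v) ^+ 2 =
  norm2 h + norm2 h + \sum_u \sum_v w u v * (h u * h v) *+ 2.
  have -> : norm2 h + norm2 h = \sum_u \sum_v w u v * h u ^+ 2 + \sum_u \sum_v w u v * h v ^+ 2.
    by rewrite (sum_weight_l (fun u => h u ^+ 2)) (sum_weight_r (fun u => h u ^+ 2)).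
  rewrite -!big_split; apply: eq_bigr => u _ /=.
  by rewrite -!big_split; apply: eq_bigr => v _ /=; ring.
have -> : \sum_u \sum_v w u v * (h u * h v) *+ 2 = (\sum_u \sum_v w u v * (h u * h v)) *+ 2.
  by rewrite -sumrMnl; apply: eq_bigr => u _; rewrite sumrMnl.
by field.
Qed.

Lemma energy_le_norm2 h : energy h <= 2 * norm2 h.
Proof.
rewrite /energy ler_pdivrMr //.
have -> : 2 * norm2 h * 2 = \sum_u \sum_v w u v * (2 * h u ^+ 2) + \sum_u \sum_v w u v * (2 * h v ^+ 2).
  rewrite (sum_weight_l (fun u => 2 * h u ^+ 2)) (sum_weight_r (fun u => 2 * h u ^+ 2)).
  rewrite -big_split /= /norm2 mulr_sumr mulr_suml; apply: eq_bigr => u _; ring.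
rewrite -big_split ler_sum // => u _; rewrite -big_split ler_sum // => v _ /=.
rewrite -mulrDr ler_wpM2l ?weight_ge0 //.
by have := sqr_ge0 (h u - h v); nra.
Qed.

(** The substitution by the square root of [D]: it turns the Euclidean norm into [norm2] and the
    quadratic form of [Mmat w] into [energy]. *)
Definition scaled_row (h : 'I_n -> R) : 'rV[R]_n := \row_v (h v * Num.sqrt (deg w v)).

Lemma scaled_row_norm h : (scaled_row h *m (scaled_row h)^T) 0 0 = norm2 h.
Proof.
rewrite mxE; apply: eq_bigr => v _; rewrite !mxE.
rewrite -[in RHS](sqr_sqrtr (ltW (deg_gt0 v))); ring.
Qed.

Lemma Mmat_sym : (Mmat w)^T = Mmat w.
Proof.
have sA : (adjA w)^T = adjA w by apply/matrixP=> i j; rewrite !mxE; case: hw.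
by rewrite /Mmat linearD /= trmx1 !trmx_mul sA tr_diag_mx mulmxA.
Qed.

Lemma scaled_row_form h :
  (scaled_row h *m Mmat w *m (scaled_row h)^T) 0 0 = energy h.
Proof.
rewrite /Mmat mulmxDr mulmx1 mulmxDl mxE scaled_row_norm energyE; congr (_ + _).
have -> : scaled_row h *m (Dmhalf w *m adjA w *m Dmhalf w) *m (scaled_row h)^T =
   (scaled_row h *m Dmhalf w) *m adjA w *m (scaled_row h *m Dmhalf w)^T.
  by rewrite trmx_mul tr_diag_mx !mulmxA.
have -> : scaled_row h *m Dmhalf w = \row_v h v.
  apply/rowP => v; rewrite mul_mx_diag !mxE mulfK //.
  by rewrite gt_eqF // sqrtr_gt0 deg_gt0.
rewrite mxE exchange_big; apply: eq_bigr => v _; rewrite mxE mulr_suml.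
by apply: eq_bigr => u _; rewrite !mxE; ring.
Qed.

End Energy.

(** * Squares of sums with at most one nonzero term *)

Section DisjointSums.
Variables (R : realFieldType).

(** At most one [a i] and one [b j] are nonzero. If they share an index, the right-hand sum is the
    square of the total; otherwise it is the sum of the two squares, which costs the factor 2. *)
Lemma disjoint_sum_sqr_le k (a b : 'I_k -> R) :
  (forall i j, i != j -> a i * a j = 0) -> (forall i j, i != j -> b i * b j = 0) ->
  (\sum_i a i + \sum_i b i) ^+ 2 <= 2 * \sum_i (a i + b i) ^+ 2.
Proof.
move=> da db.
have sq (c : 'I_k -> R) : (forall i j, i != j -> c i * c j = 0) -> (\sum_i c i) ^+ 2 = \sum_i c i ^+ 2.
  move=> dc; rewrite expr2 mulr_suml; apply: eq_bigr => i _.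
  rewrite mulr_sumr (bigD1 i) //= big1 ?addr0 // => j; rewrite eq_sym; exact: dc.
set P := \sum_i a i * b i.
(* The two cases in algebraic form: the overlap [P] is either zero or the full product of the
   sums. *)
have PP : P * (P - (\sum_i a i) * (\sum_i b i)) = 0.
  have PA : P * \sum_i a i = \sum_i a i ^+ 2 * b i.
    rewrite /P mulr_suml; apply: eq_bigr => i _; rewrite mulr_sumr (bigD1 i) //= big1 ?addr0; first by ring.
    by move=> j ij; rewrite mulrAC da ?mul0r // eq_sym.
  have PAB : P * (\sum_i a i) * (\sum_i b i) = \sum_i (a i * b i) ^+ 2.
    rewrite PA mulr_suml; apply: eq_bigr => i _; rewrite mulr_sumr (bigD1 i) //= big1 ?addr0; first by ring.
    by move=> j ij; rewrite -mulrA db ?mulr0 // eq_sym.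
  rewrite mulrBr mulrA PAB -expr2 sq ?subrr // => i j ij.
  by rewrite mulrACA da ?mul0r.
have -> : \sum_i (a i + b i) ^+ 2 = (\sum_i a i) ^+ 2 + (\sum_i b i) ^+ 2 + 2 * P.
  rewrite !sq // /P mulr_sumr -!big_split /=; apply: eq_bigr => i _; ring.
move: PP => /eqP; rewrite mulf_eq0 subr_eq0 => /orP[]/eqP PE.
  by have := sqr_ge0 (\sum_i a i - \sum_i b i); rewrite PE; nra.
by have := sqr_ge0 (\sum_i a i + \sum_i b i); rewrite PE; nra.
Qed.
End DisjointSums.

(** * Eigenvalues bounded through disjointly supported functions *)

Section DisjointSupports.
Variables (R : rcfType) (n : nat) (w : 'I_n -> 'I_n -> R).
Hypothesis hw : is_weighted_graph w.
Hypothesis hdeg : forall v, 1 <= deg w v.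
Variables (alpha : seq R) (halpha : is_sorted_spectrum w alpha) (k : nat).
Hypothesis hk : (0 < k <= n)%N.

(** Courant-Fischer on the span of the [g i]: by disjointness [norm2] is additive there, and
    [energy] is subadditive up to the factor 2, since an edge may join two supports. *)
Lemma disjoint_rayleigh_ge (g : 'I_k -> 'I_n -> R) :
  (forall i, exists v, g i v != 0) ->
  (forall i j v, i != j -> g i v * g j v = 0) ->
  exists i, alpha`_k.-1 * norm2 w (g i) <= 2 * energy w (g i).
Proof.
move=> g0 dg; have [ss [so cM]] := halpha.
pose W : 'M[R]_(k, n) := \matrix_i scaled_row w (g i).
have yW (y : 'rV_k) : y *m W = scaled_row w (fun v => \sum_i y 0 i * g i v).
  apply/rowP => v; rewrite !mxE mulr_suml; apply: eq_bigr => i _; rewrite !mxE; ring.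
(* At a vertex where [g i] is nonzero all other [g j] vanish, which isolates the coefficient
   [y 0 i]. *)
have fW : row_free W.
  rewrite -kermx_eq0; apply/rowV0P => y /sub_kermxP yW0; apply/rowP => i; rewrite [RHS]mxE.
  have [v gv] := g0 i; have /rowP/(_ v) := yW0; rewrite yW !mxE => /eqP.
  rewrite mulf_eq0 orbC gt_eqF ?sqrtr_gt0 ?deg_gt0 //= => /eqP s0.
  apply: (mulIf (mulf_neq0 gv gv)); rewrite mul0r mulrA.
  rewrite -(mul0r (g i v)) -s0 mulr_suml (bigD1 i) //= big1 ?addr0 // => j ji.
  by rewrite -mulrA dg ?mulr0.
have [y y0] := sym_minmax (Mmat_sym hw) ss so cM hk fW.
rewrite yW scaled_row_norm // scaled_row_form // => ale.
set h := fun v => _ in ale.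
have nh : norm2 w h = \sum_i y 0 i ^+ 2 * norm2 w (g i).
  under eq_bigr do rewrite mulr_sumr.
  rewrite exchange_big; apply: eq_bigr => v _ /=.
  rewrite /h expr2 mulr_suml mulr_sumr; apply: eq_bigr => i _ /=.
  rewrite mulr_sumr (bigD1 i) //= big1 ?addr0; first by ring.
  by move=> j ij; rewrite mulrACA (dg _ _ v) ?mulr0 // eq_sym.
have eh : energy w h <= 2 * \sum_i y 0 i ^+ 2 * energy w (g i).
  rewrite /energy mulr_sumr.
  under [leRHS]eq_bigr => i _ do rewrite mulrA mulrA mulr_sumr.
  rewrite -mulr_suml ler_wpM2r ?invr_ge0 // [leRHS]exchange_big ler_sum //= => u _.
  under [leRHS]eq_bigr => i _ do rewrite mulr_sumr.
  rewrite [leRHS]exchange_big ler_sum //= => v _.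
  have -> : \sum_i 2 * y 0 i ^+ 2 * (w u v * (g i u + g i v) ^+ 2) =
    w u v * (2 * \sum_i (y 0 i * g i u + y 0 i * g i v) ^+ 2).
    by rewrite !mulr_sumr; apply: eq_bigr => i _; ring.
  rewrite ler_wpM2l ?weight_ge0 //; apply: disjoint_sum_sqr_le => i j ij.
    by rewrite mulrACA dg ?mulr0.
  by rewrite mulrACA dg ?mulr0.
(* If every [g i] violated the bound, summing with the weights [y 0 i ^+ 2], not all zero, would
   contradict [ale] and [eh]. *)
apply/existsP; apply: contraT; rewrite negb_exists => /forallP al.
have [i yi] : exists i, y 0 i != 0.
  by apply/existsP; apply: contraNT y0; rewrite negb_exists => /forallP a0;
     apply/eqP/rowP => i; rewrite mxE; apply/eqP; move: (a0 i); rewrite negbK.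
have : alpha`_k.-1 * norm2 w h <= 2 * \sum_i y 0 i ^+ 2 * energy w (g i) := le_trans ale eh.
rewrite nh !mulr_sumr leNgt => /negP[].
rewrite (bigD1 i) //= [ltRHS](bigD1 i) //=; apply: ltr_leD.
  rewrite mulrCA [ltRHS]mulrCA ltr_pM2l; first by rewrite ltNge.
  by rewrite lt_neqAle sqr_ge0 eq_sym sqrf_eq0 yi.
apply: ler_sum => j _; rewrite mulrCA [leRHS]mulrCA ler_wpM2l ?sqr_ge0 //.
by rewrite ltW // ltNge.
Qed.

(** Indicators of [k] distinct vertices have Rayleigh quotient at most 2, and the preceding lemma
    doubles this. The bound serves to absorb a constant in the final estimate. *)
Lemma alpha_le4 : alpha`_k.-1 <= 4.
Proof.
case/andP: hk => k0 kn.
pose g (i : 'I_k) (v : 'I_n) : R := (v == widen_ord kn i)%:R.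
have [|i j v ij|i] := @disjoint_rayleigh_ge g.
- by move=> i; exists (widen_ord kn i); rewrite /g eqxx oner_eq0.
- rewrite /g; case: eqP => [->|]; last by rewrite mul0r.
  by rewrite (inj_eq _) ?(negPf ij) ?mulr0 // => a b /(congr1 val) /= /val_inj.
have ng : 0 < norm2 w (g i).
  by apply: norm2_gt0 => //; exists (widen_ord kn i); rewrite /g eqxx oner_eq0.
move=> le1; rewrite -(ler_pM2r ng) (le_trans le1) //.
by have := energy_le_norm2 hw (g i); lra.
Qed.

End DisjointSupports.

(** * The tent function on one interval and its integral *)

Section OneInterval.
Variable R : realFieldType.
Implicit Types a b x y p q l : R.

(** For [a <= b], the length of the part of [[a, b]] below [x]. *)
Definition clip a b x := Num.min x b - Num.min x a.
(** Distance from [p] to the nearer endpoint of [[0, l]]. *)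
Definition hat p l := Num.min p (l - p).
(* the integral of [hat ^~ l] from 0 to [p] *)
Definition hat_int p l :=
  if p <= l / 2 then p ^+ 2 / 2 else l ^+ 2 / 4 - (l - p) ^+ 2 / 2.

Lemma clip_bounds a b x : a <= b -> 0 <= clip a b x <= b - a.
Proof. by rewrite /clip /Order.min => ab; do 2!case: ltP => ?; lra. Qed.

Lemma clip_le a b x y : a <= b -> x <= y -> clip a b x <= clip a b y.
Proof. by rewrite /clip /Order.min => ab xy; do 4!case: ltP => ?; lra. Qed.

Lemma hat_bounds p l : 0 <= p <= l -> 0 <= hat p l <= p.
Proof. by rewrite /hat /Order.min => pl; case: ltP => ?; lra. Qed.

Lemma hat_lip p q l : p <= q -> `|hat q l - hat p l| <= q - p.
Proof.
by rewrite /hat /Order.min ler_norml => pq; do 2!case: ltP => ?; lra.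
Qed.

Lemma hat_int_ge p l : 0 <= p <= l -> p ^+ 2 / 4 <= hat_int p l.
Proof.
rewrite /hat_int => /andP[p0 pl]; case: (leP p) => lp; first by have := sqr_ge0 p; lra.
(* The gap to be shown non-negative is [(l - p) * (3 * p - l) / 4], a positive combination of this
   product and the next one. *)
have : 0 <= (l - p) * (p - l / 2) by apply: mulr_ge0; lra.
have : 0 <= (l - p) * p by apply: mulr_ge0; lra.
by nra.
Qed.

Lemma hat_int_le p l : 0 <= p <= l -> hat_int p l <= p ^+ 2 / 2.
Proof.
rewrite /hat_int => /andP[p0 pl]; case: (leP p) => // lp.
by have := sqr_ge0 (p - l / 2); nra.
Qed.

Lemma hat_int_homo p q l : 0 <= p -> p <= q -> q <= l -> hat_int p l <= hat_int q l.
Proof.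
rewrite /hat_int => p0 pq ql; case: (leP p) => lp; case: (leP q) => lq; nra.
Qed.

(* [hat] is 1-Lipschitz, so its mean over [p, q] exceeds the mean of its
   endpoint values by at most (q - p) / 2. *)
Lemma hat_int_diff_le p q l : 0 <= p -> p <= q -> q <= l ->
  hat_int q l - hat_int p l <= (q - p) * (hat p l + hat q l + (q - p)) / 2.
Proof.
rewrite /hat_int /hat /Order.min => p0 pq ql.
case: (leP q (l / 2)) => lq; case: (leP p (l / 2)) => lp; case: (ltP p) => lp'; case: (ltP q) => lq';
  first [lra | nra].
Qed.
End OneInterval.

(** * Tents over a sequence of thresholds *)

Section Thresholds.
Variables (R : realFieldType) (t : nat -> R) (m : nat).
Implicit Types a b x y z : R.

Definition piece i x := clip (t i) (t i.+1) x.
Definition width i := t i.+1 - t i.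
Definition tent i x := hat (piece i x) (width i).
(* distance from [x] to the nearest threshold *)
Definition tents x := \sum_(i < m) tent i x.
Definition tents_int x := \sum_(i < m) hat_int (piece i x) (width i).
(** Transfers a function of [|f|] to one signed like [f], so that cancellation in [f u + f v] is
    preserved. *)
Definition odd_ext (phi : R -> R) a := if 0 <= a then phi a else - phi (- a).

Hypothesis t_le : forall i, t i <= t i.+1.
Hypothesis t0 : t 0 = 0.

Lemma threshold_le i j : (i <= j)%N -> t i <= t j.
Proof. by move=> ij; apply: (homo_leq lexx le_trans t_le). Qed.

Lemma piece_bounds i x : 0 <= piece i x <= width i. Proof. exact: clip_bounds. Qed.

Lemma piece_ge0 i x : 0 <= piece i x. Proof. by case/andP: (piece_bounds i x). Qed.

Lemma piece_le_width i x : piece i x <= width i. Proof. by case/andP: (piece_bounds i x). Qed.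

Lemma piece_homo i x y : x <= y -> piece i x <= piece i y. Proof. exact: clip_le. Qed.

Lemma sum_piece_min x : 0 <= x -> \sum_(i < m) piece i x = Num.min x (t m).
Proof.
move=> x0; rewrite -(big_mkord xpredT (fun i => piece i x)).
rewrite (telescope_sumr (fun i => Num.min x (t i)) (leq0n m)).
by rewrite t0 (min_r x0) subr0.
Qed.

Lemma sum_piece x : 0 <= x <= t m -> \sum_(i < m) piece i x = x.
Proof. by move=> /andP[x0 xm]; rewrite sum_piece_min // min_l. Qed.

Lemma tent_bounds i x : 0 <= tent i x <= piece i x.
Proof. exact/hat_bounds/piece_bounds. Qed.

Lemma tent_ge0 i x : 0 <= tent i x. Proof. by case/andP: (tent_bounds i x). Qed.

Lemma tent_le_piece i x : tent i x <= piece i x. Proof. by case/andP: (tent_bounds i x). Qed.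

Lemma tent_le_tents (i : 'I_m) x : tent i x <= tents x.
Proof.
rewrite /tents (bigD1 i) //= lerDl sumr_ge0 // => j _; exact: tent_ge0.
Qed.

(** For [i < j], either [x] is at most [t j] and piece [j] is empty, or piece [i] is full; [hat]
    vanishes at both ends. *)
Lemma tent_mul_eq0 i j x : i != j -> tent i x * tent j x = 0.
Proof.
wlog ij : i j / (i < j)%N => [hw|].
  by rewrite neq_ltn => /orP[] ij; [|rewrite mulrC]; apply: hw; rewrite // neq_ltn ij.
move=> _; have tij := threshold_le ij; have ti := t_le i; have tj := t_le j.
have [xt|xt] := leP x (t j).
  have pj : piece j x = 0 by rewrite /piece /clip !min_l ?(le_trans xt) // subrr.
  by rewrite {2}/tent /hat pj min_l ?mulr0 // subr0 subr_ge0.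
have pi : piece i x = width i.
  rewrite /piece /clip /width !(min_r (y := t _)) //; apply/ltW; apply: le_lt_trans xt => //.
  exact: le_trans tij.
by rewrite {1}/tent /hat pi subrr min_r ?mul0r // subr_ge0.
Qed.

Lemma tents_sqr x : tents x ^+ 2 = \sum_(i < m) tent i x ^+ 2.
Proof.
rewrite expr2 mulr_suml; apply: eq_bigr => i _.
by rewrite mulr_sumr (bigD1 i) //= big1 ?addr0 // => j ji; rewrite tent_mul_eq0 // eq_sym.
Qed.

Lemma sum_sqr_le_sqr_sum k (a : 'I_k -> R) :
  (forall i, 0 <= a i) -> \sum_i a i ^+ 2 <= (\sum_i a i) ^+ 2.
Proof.
move=> a0; rewrite expr2 mulr_suml ler_sum // => i _; rewrite expr2 ler_wpM2l //.
by rewrite (bigD1 i) //= lerDl sumr_ge0.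
Qed.

(** Cauchy-Schwarz against the constant vector, from the sum of all squared differences. *)
Lemma sqr_sum_le k (a : 'I_k -> R) : (\sum_i a i) ^+ 2 <= k%:R * \sum_i a i ^+ 2.
Proof.
have : 0 <= \sum_(i < k) \sum_(j < k) (a i - a j) ^+ 2.
  by do 2!(apply: sumr_ge0 => ? _); exact: sqr_ge0.
have -> : \sum_(i < k) \sum_(j < k) (a i - a j) ^+ 2 =
   2 * (k%:R * (\sum_i a i ^+ 2) - (\sum_i a i) ^+ 2).
  have -> : \sum_(i < k) \sum_(j < k) (a i - a j) ^+ 2 =
    \sum_(i < k) (k%:R * a i ^+ 2 + \sum_j a j ^+ 2 - 2 * a i * \sum_j a j).
    apply: eq_bigr => i _.
    have -> : k%:R * a i ^+ 2 = \sum_(j < k) a i ^+ 2.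
      by rewrite sumr_const card_ord mulr_natl.
    by rewrite mulr_sumr -big_split -sumrB; apply: eq_bigr => j _ /=; ring.
  rewrite sumrB big_split /= sumr_const card_ord -mulr_sumr -mulr_suml -mulr_sumr -mulr_natl.
  ring.
by rewrite pmulr_rge0 // subr_ge0.
Qed.

(** Splitting [x] into its [m] pieces costs the factor [m] by Cauchy-Schwarz; each piece then costs
    the factor 4. This is one of the places where the number of intervals enters the final bound. *)
Lemma tents_int_ge x : 0 <= x <= t m -> x ^+ 2 <= 4 * m%:R * tents_int x.
Proof.
move=> x0m; rewrite -{1}(sum_piece x0m) (le_trans (sqr_sum_le _)) //.
rewrite [4 * _]mulrC -mulrA ler_wpM2l // mulr_sumr ler_sum // => i _.
have := hat_int_ge (piece_bounds i x); lra.
Qed.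

Lemma tents_int_le x : 0 <= x <= t m -> tents_int x <= x ^+ 2 / 2.
Proof.
move=> x0m; rewrite -{2}(sum_piece x0m) ler_pdivlMr //.
apply: le_trans (sum_sqr_le_sqr_sum _) => [|i]; last exact: piece_ge0.
rewrite mulr_suml ler_sum // => i _.
have := hat_int_le (piece_bounds i x); lra.
Qed.

Lemma tents_int_homo x y : x <= y -> tents_int x <= tents_int y.
Proof.
move=> xy; apply: ler_sum => i _; apply: hat_int_homo.
- exact: piece_ge0.
- exact: piece_homo.
- exact: piece_le_width.
Qed.

Lemma piece0 i : piece i 0 = 0.
Proof.
have ti j : 0 <= t j by rewrite -t0; exact: threshold_le.
by rewrite /piece /clip !min_l ?ti // subrr.
Qed.

Lemma tents_int0 : tents_int 0 = 0.
Proof.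
rewrite /tents_int big1 // => i _; rewrite piece0 /hat_int ifT; first by rewrite expr0n mul0r.
by rewrite divr_ge0 // subr_ge0.
Qed.

Lemma tents_ge0 x : 0 <= tents x.
Proof. by apply: sumr_ge0 => i _; exact: tent_ge0. Qed.

Lemma tents_int_diff_le x y : 0 <= x -> x <= y -> y <= t m ->
  tents_int y - tents_int x <= (y - x) * (tents x + tents y + (y - x)) / 2.
Proof.
move=> x0 xy ym; have x0m : 0 <= x <= t m by rewrite x0 (le_trans xy).
have y0m : 0 <= y <= t m by rewrite (le_trans x0 xy).
have e : y - x = \sum_(i < m) (piece i y - piece i x) by rewrite sumrB !sum_piece.
rewrite -sumrB {1}e !mulr_suml ler_sum // => i _.
apply: le_trans (hat_int_diff_le (piece_ge0 i x) (piece_homo i xy) (piece_le_width i y)) _.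
rewrite ler_wpM2r ?invr_ge0 // ler_wpM2l ?subr_ge0 ?piece_homo //.
apply: lerD; first by apply: lerD; exact: tent_le_tents.
rewrite e (bigD1 i) //= lerDl sumr_ge0 // => j _.
by rewrite subr_ge0 piece_homo.
Qed.

(** For equal signs, [tents_int x <= x ^+ 2 / 2] already suffices. For opposite signs the sum is a
    difference of two integrals, bounded by [tents_int_diff_le]. *)
Lemma odd_ext_tents_int_le a b : `|a| <= t m -> `|b| <= t m ->
  `|odd_ext tents_int a + odd_ext tents_int b| <=
  `|a + b| * (tents `|a| + tents `|b| + `|a + b|) / 2.
Proof.
have same x y : 0 <= x <= t m -> 0 <= y <= t m ->
    tents_int x + tents_int y <= (x + y) * (tents x + tents y + (x + y)) / 2.
  move=> x0m y0m; have := tents_int_le x0m; have := tents_int_le y0m.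
  have : 0 <= (x + y) * (tents x + tents y).
    by case/andP: x0m => ? _; case/andP: y0m => ? _; rewrite mulr_ge0 ?addr_ge0 ?tents_ge0.
  have : 0 <= x * y by case/andP: x0m => ? _; case/andP: y0m => ? _; rewrite mulr_ge0.
  nra.
have opp x y : 0 <= x <= t m -> 0 <= y <= t m ->
    `|tents_int x - tents_int y| <= `|x - y| * (tents x + tents y + `|x - y|) / 2.
  wlog xy : x y / x <= y => [hw|].
    move=> x0m y0m; have [xy|/ltW xy] := leP x y; first exact: hw.
    by rewrite distrC (distrC x) (addrC (tents x)); exact: hw.
  move=> /andP[x0 _] /andP[_ ym].
  rewrite distrC (distrC x) !ger0_norm ?subr_ge0 //; last exact: tents_int_homo.
  exact: tents_int_diff_le.
have H0 x : 0 <= x -> 0 <= tents_int x by move=> x0; rewrite -[leLHS]tents_int0; exact: tents_int_homo.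
move=> am bm; rewrite /odd_ext.
have na : 0 <= `|a| <= t m by rewrite normr_ge0.
have nb : 0 <= `|b| <= t m by rewrite normr_ge0.
case: (leP 0 a) => a0; case: (leP 0 b) => b0.
- move: na nb; rewrite !ger0_norm ?addr_ge0 ?H0 //; exact: same.
- move: na nb; rewrite (ger0_norm a0) (ltr0_norm b0) => na nb.
  by have := opp _ _ na nb; rewrite opprK.
- move: na nb; rewrite (ltr0_norm a0) (ger0_norm b0) => na nb.
  have := opp _ _ na nb; rewrite [`|- a - b|](_ : _ = `|a + b|); last by rewrite -opprD normrN.
  by rewrite distrC addrC.
move: na nb; rewrite (ltr0_norm a0) (ltr0_norm b0) => na nb.
rewrite -opprD normrN (ltr0_norm (_ : a + b < 0)); last lra.
rewrite ger0_norm; last by rewrite addr_ge0 ?H0 ?oppr_ge0 ?ltW.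
by rewrite opprD; exact: same.
Qed.

(** Each tent is bounded by its piece (equal signs) and is 1-Lipschitz in it (opposite signs). A sum
    of squares of non-negative numbers is at most the square of their sum, and the pieces
    telescope. *)
Lemma odd_ext_tent_le a b :
  \sum_(i < m) (odd_ext (tent i) a + odd_ext (tent i) b) ^+ 2 <= (a + b) ^+ 2.
Proof.
have tm0 : 0 <= t m by rewrite -t0; exact: threshold_le.
have same x y : 0 <= x -> 0 <= y -> \sum_(i < m) (tent i x + tent i y) ^+ 2 <= (x + y) ^+ 2.
  move=> x0 y0.
  apply: (@le_trans _ _ ((\sum_(i < m) (piece i x + piece i y)) ^+ 2)); last first.
    rewrite big_split /= !sum_piece_min // ler_sqr ?nnegrE ?addr_ge0 //.
    - by rewrite lerD // ge_min lexx.
    - by rewrite le_min x0.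
    - by rewrite le_min y0.
  apply: le_trans (sum_sqr_le_sqr_sum _) => [|i]; last by apply: addr_ge0; exact: piece_ge0.
  apply: ler_sum => i _; rewrite ler_sqr ?nnegrE.
  - by apply: lerD; exact: tent_le_piece.
  - by apply: addr_ge0; exact: tent_ge0.
  by apply: addr_ge0; exact: piece_ge0.
have opp : forall x y, 0 <= x -> 0 <= y -> \sum_(i < m) (tent i x - tent i y) ^+ 2 <= (x - y) ^+ 2.
  move=> x y; wlog xy : x y / x <= y => [hw|].
    move=> x0 y0; have [xy|/ltW xy] := leP x y; first exact: hw.
    rewrite -sqrrN opprB; under eq_bigr do rewrite -sqrrN opprB.
    exact: hw.
  move=> x0 y0; rewrite -[leRHS]sqrrN opprB.
  apply: (@le_trans _ _ ((\sum_(i < m) (piece i y - piece i x)) ^+ 2)); last first.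
    rewrite sumrB !sum_piece_min // ler_sqr ?nnegrE ?subr_ge0 //.
      by rewrite /Order.min; do 2!case: ltP => ?; lra.
    by rewrite le_min !ge_min xy lexx orbT.
  apply: le_trans (sum_sqr_le_sqr_sum _) => [|i]; last by rewrite subr_ge0 piece_homo.
  apply: ler_sum => i _; rewrite -(real_normK (num_real (tent i x - _))) distrC.
  rewrite ler_sqr ?nnegrE ?normr_ge0 ?subr_ge0 ?piece_homo //.
  exact/hat_lip/piece_homo.
rewrite /odd_ext; case: (leP 0 a) => a0; case: (leP 0 b) => b0.
- exact: same.
- by have := opp a (- b) a0; rewrite opprK oppr_ge0 ltW // => /(_ isT).
- have := opp b (- a) b0; rewrite opprK oppr_ge0 ltW // => /(_ isT).
  by rewrite addrC; under eq_bigr do rewrite addrC.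
have := same (- a) (- b); rewrite !oppr_ge0 (ltW a0) (ltW b0) => /(_ isT isT).
rewrite -opprD sqrrN.
by under [X in _ -> X <= _]eq_bigr do rewrite -opprD sqrrN.
Qed.

End Thresholds.

(** * Greedy choice of the thresholds *)

Section ThresholdChoice.
Variable R : rcfType.

(** Over a real closed field polynomials have the intermediate value property, but continuous
    functions in general do not. The interval is split at the breakpoints in [s], keeping each time
    a half whose end values enclose [y]. *)
Lemma piecewise_poly_ivt (phi : R -> R) (s : seq R) a b y : a <= b ->
  (forall c d, a <= c -> c <= d -> d <= b -> {in s, forall e, ~~ (c < e < d)} ->
     exists p : {poly R}, forall x, c <= x <= d -> phi x = p.[x]) ->
  phi a <= y <= phi b -> exists2 x, a <= x <= b & phi x = y.
Proof.
elim: s a b => [|e s IH] a b ab pw /andP[ya yb].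
  have [//|p pE] := pw a b (lexx a) ab (lexx b).
  have [|x xab /rootP] := @poly_ivt R (p - y%:P) a b ab; last first.
    rewrite !hornerE => /eqP; rewrite subr_eq0 => /eqP px.
    by exists x; rewrite ?pE.
  by rewrite !hornerE -!pE ?lexx ?ab // subr_le0 ya subr_ge0.
have restrict a' b' : a <= a' -> b' <= b -> ~~ (a' < e < b') ->
    forall c d, a' <= c -> c <= d -> d <= b' -> {in s, forall e, ~~ (c < e < d)} ->
     exists p : {poly R}, forall x, c <= x <= d -> phi x = p.[x].
  move=> aa bb ne c d ac cd db nb; apply: pw => //; [exact: le_trans ac|exact: le_trans bb|].
  move=> z; rewrite inE => /orP[/eqP->|]; last exact: nb.
  apply: contra ne => /andP[ce ed].
  by rewrite (le_lt_trans ac ce) (lt_le_trans ed db).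
have [/andP[ae eb]|ne] := boolP (a < e < b); last first.
  by apply: IH => //; [exact: restrict | rewrite ya].
have [ye|ye] := leP y (phi e).
  have [||x /andP[ax xe] px] := IH a e (ltW ae); last first.
  - by exists x; rewrite ?ax ?(le_trans xe) ?ltW.
  - by rewrite ya.
  - by apply: (restrict a e (lexx a) (ltW eb)); rewrite ltxx andbF.
have [||x /andP[ex xb] px] := IH e b (ltW eb); last first.
- by exists x; rewrite ?xb ?andbT ?(le_trans _ ex) ?ltW.
- by rewrite ltW.
- by apply: (restrict e b (ltW ae) (lexx b)); rewrite ltxx.
Qed.

Variables (n : nat) (c x : 'I_n -> R).
Definition mass a b := \sum_v c v * hat (clip a b (x v)) (b - a) ^+ 2.

Lemma mass_diag a : mass a a = 0.
Proof.
apply: big1 => v _; rewrite /clip !subrr /hat subrr minxx expr0n mulr0 //.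
Qed.

(* As a function of [b], the summand of [v] is 0 up to [b = x v]; from then on the
   nearest endpoint to [x v] is [b], until [b = 2 (x v) - a], and [a] afterwards. *)
Lemma mass_ivt a b y : a <= b -> 0 <= y <= mass a b ->
  exists2 z, a <= z <= b & mass a z = y.
Proof.
move=> ab; rewrite -[X in X <= y <= _](mass_diag a).
apply: (@piecewise_poly_ivt (mass a)
  ([seq x v | v <- enum 'I_n] ++ [seq 2 * x v - a | v <- enum 'I_n])) => // l r al lr rb nb.
have n1 v : ~~ (l < x v < r).
  by apply: nb; rewrite mem_cat map_f ?mem_enum.
have n2 v : ~~ (l < 2 * x v - a < r).
  by apply: nb; rewrite mem_cat orbC (map_f (fun v => 2 * x v - a)) ?mem_enum.
pose p v : {poly R} := if (x v <= a) || (r <= x v) then 0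
  else if r <= 2 * x v - a then 'X - (x v)%:P else (x v - a)%:P.
exists (\sum_v (c v)%:P * p v ^+ 2) => z /andP[lz zr].
rewrite horner_sum; apply: eq_bigr => v _; rewrite hornerM hornerC horner_exp.
congr (_ * _ ^+ 2); move: (n1 v) (n2 v); rewrite /p /hat /clip !negb_and -!leNgt.
have [xa|xa] := leP (x v) a => /=.
  move=> _ _; rewrite horner0 (min_l (y := z)); last lra.
  by rewrite subrr subr0 min_l //; lra.
have [xr|xr] := leP r (x v) => /=.
  move=> _ _; rewrite horner0 (min_r (x := x v) (y := z)); last lra.
  by rewrite min_r; lra.
rewrite orbF => xl; rewrite (min_l (x := x v) (y := z)); last lra.
have [r2|r2] := leP r (2 * x v - a) => /= n2v; rewrite !hornerE.
  by rewrite min_r; lra.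
by rewrite min_l; lra.
Qed.

Lemma threshold_sequence C M : 0 <= C -> 0 <= M -> exists t : nat -> R,
  t 0 = 0 /\ forall i, [/\ t i <= t i.+1, t i.+1 <= M, mass (t i) (t i.+1) <= C &
    t i.+1 = M \/ mass (t i) (t i.+1) = C].
Proof.
move=> C0 M0.
(* A boolean specification, made total by the implication, so that [xchoose] yields a step function
   to iterate. *)
pose ok a b := (a <= M) ==> [&& a <= b, b <= M, mass a b <= C & (b == M) || (mass a b == C)].
have ex a : exists b, ok a b.
  rewrite /ok; have [aM|] /= := boolP (a <= M); last by exists 0.
  have [mC|/ltW Cm] := leP (mass a M) C; first by exists M; rewrite aM mC lexx eqxx.
  have [|b /andP[ab bM] mb] := mass_ivt aM (y := C); first by rewrite C0.
  by exists b; rewrite ab bM mb lexx eqxx orbT.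
pose step a := xchoose (ex a).
have stepP a : a <= M -> [&& a <= step a, step a <= M, mass a (step a) <= C &
    (step a == M) || (mass a (step a) == C)] by exact: (implyP (xchooseP (ex a))).
clearbody step; exists (fun i => iter i step 0); split=> // i.
have tM : iter i step 0 <= M by elim: i => //= i /stepP/and4P[].
have /and4P[h1 h2 h3 /orP h4] := stepP _ tM.
by split=> //; case: h4 => /eqP; [left | right].
Qed.

End ThresholdChoice.

(** * Level cuts and the coarea inequality *)

Section Coarea.
Variables (R : rcfType) (n : nat) (w : 'I_n -> 'I_n -> R).
Hypothesis hw : is_weighted_graph w.
Hypothesis hdeg : forall v, 1 <= deg w v.

(** For [t > 0], the signed indicator of the level cut: 1 on [Rf f t], -1 on [Lf f t], 0
    elsewhere. *)
Definition cut_sign (t a : R) : R := (t <= a)%R%:R - (a <= - t)%R%:R.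

Lemma vol_gt0 S : S != set0 -> 0 < vol w S.
Proof.
case/set0Pn => v vS; rewrite /vol (bigD1 v) //= ltr_pwDl ?deg_gt0 //.
by apply: sumr_ge0 => u _; rewrite ltW ?deg_gt0.
Qed.

(** The absolute value is 2 on edges inside one side, 1 on edges leaving the union, and 0 on edges
    between the sides or outside; halving corrects for ordered pairs. *)
Lemma bip_numeratorE f t : 0 < t ->
  2 * wE w (Lf f t) + 2 * wE w (Rf f t) + wE2 w (Lf f t :|: Rf f t) (~: (Lf f t :|: Rf f t))
  = (\sum_u \sum_v w u v * `|cut_sign t (f u) + cut_sign t (f v)|) / 2.
Proof.
move=> t0; have [sw _] := hw.
have sumE (S T : {set 'I_n}) : \sum_(u in S) \sum_(v in T) w u v =
    \sum_u \sum_v w u v * ((u \in S)%:R * (v \in T)%:R).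
  rewrite big_mkcond; apply: eq_bigr => u _; case: (u \in S) => /=.
    by rewrite big_mkcond; apply: eq_bigr => v _; case: (v \in T); rewrite mul1r ?mulr1 ?mulr0.
  by rewrite big1 // => v _; rewrite mul0r mulr0.
rewrite /wE /wE2 !sumE.
set U := Lf f t :|: Rf f t.
(* [wE2] counts a boundary edge only from its inner endpoint, so this term is symmetrized before
   comparing summands. *)
have symU : \sum_u \sum_v w u v * ((u \in U)%:R * (v \in ~: U)%:R) =
   (\sum_u \sum_v w u v * ((u \in U)%:R * (v \in ~: U)%:R + (v \in U)%:R * (u \in ~: U)%:R)) / 2.
  set X := LHS; have -> : \sum_u \sum_v w u v * ((u \in U)%:R * (v \in ~: U)%:R + (v \in U)%:R * (u \in ~: U)%:R) = X + X.
    rewrite /X [in X in _ = _ + X]exchange_big -big_split; apply: eq_bigr => u _ /=.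
    by rewrite -big_split; apply: eq_bigr => v _ /=; rewrite mulrDr (sw v u).
  by field.
have half2 (x : R) : 2 * (x / 2) = x by field.
rewrite symU !half2 mulr_suml [RHS]mulr_suml -!big_split /=; apply: eq_bigr => u _.
rewrite !mulr_suml -!big_split /=; apply: eq_bigr => v _.
rewrite -!mulrA -!mulrDr; congr (_ * _); rewrite /cut_sign !inE.
have lr x : f x <= - t -> (t <= f x) = false by move=> h; apply/negbTE; rewrite -ltNge; lra.
have n2 : `|-1 - 1 : R| = 2 by rewrite -opprD normrN ger0_norm //; lra.
have p2 : `|1 + 1 : R| = 2 by rewrite ger0_norm //; lra.
case: (boolP (f u <= - t)) => ul; case: (boolP (f v <= - t)) => vl; rewrite ?(lr _ ul) ?(lr _ vl) /=;
 try case: (t <= f u); try case: (t <= f v) => /=;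
 rewrite ?subr0 ?sub0r ?addr0 ?add0r ?subrr ?addNr ?normrN ?normr1 ?normr0 ?p2 ?n2; lra.
Qed.

Variables (f : 'I_n -> R) (b : R).
Hypothesis b_le : forall t, 0 < t -> Lf f t :|: Rf f t != set0 ->
  b <= bip_ratio w (Lf f t) (Rf f t).

Lemma cut_level t : 0 < t ->
  b * (\sum_v deg w v * (t <= `|f v|)%R%:R) <=
  (\sum_u \sum_v w u v * `|cut_sign t (f u) + cut_sign t (f v)|) / 2.
Proof.
move=> t0; rewrite -bip_numeratorE //; set U := Lf f t :|: Rf f t.
have -> : \sum_v deg w v * (t <= `|f v|)%R%:R = vol w U.
  rewrite /vol [RHS]big_mkcond; apply: eq_bigr => v _; rewrite !inE lerNr orbC -lerNr.
  have -> : (t <= `|f v|) = (t <= f v) || (f v <= - t) by rewrite ler_normr lerNr.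
  by case: (_ || _); rewrite ?mulr1 ?mulr0.
have [U0|U0] := eqVneq U set0.
  have -> : vol w U = 0 by rewrite /vol U0 big_set0.
  rewrite mulr0 bip_numeratorE // divr_ge0 // sumr_ge0 // => u _; rewrite sumr_ge0 // => v _.
  by rewrite mulr_ge0 ?weight_ge0.
by rewrite -ler_pdivlMr ?vol_gt0 // b_le.
Qed.

Lemma cut_sign_add_ge0 t x y : 0 < t -> 0 <= x + y -> 0 <= cut_sign t x + cut_sign t y.
Proof.
rewrite /cut_sign => t0 xy.
by case: (leP t x); case: (leP t y); case: (leP x (- t)); case: (leP y (- t)) => /=; lra.
Qed.

Lemma cut_signN t x : cut_sign t (- x) = - cut_sign t x.
Proof. by rewrite /cut_sign lerN2 lerNr opprB. Qed.

(* The layer-cake formula for [phi `|f v|], over the finitely many levels [`|f v|]. *)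
Lemma coarea phi : phi 0 = 0 -> {homo phi : x y / x <= y} ->
  b * (\sum_v deg w v * phi `|f v|) <=
  (\sum_u \sum_v w u v * `|odd_ext phi (f u) + odd_ext phi (f v)|) / 2.
Proof.
move=> phi0 hphi.
(* The leading 0 lets the telescoping start from [phi 0 = 0]; repeated levels are harmless, their
   jumps [D j] being zero. *)
pose s := 0 :: sort <=%R [seq `|f v| | v <- enum 'I_n].
pose tau := nth 0 s.
have ss : sorted <=%R s.
  rewrite /s /= path_sortedE; last exact: le_trans.
  rewrite sort_le_sorted andbT; apply/allP => x; rewrite mem_sort => /mapP[v _ ->].
  exact: normr_ge0.
have sz : size s = n.+1 by rewrite /= size_sort size_map size_enum_ord.
have tau_le i j : (i <= j)%N -> (j <= n)%N -> tau i <= tau j.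
  move=> ij jn; apply: (sorted_leq_nth le_trans le_refl) => //; rewrite inE sz ltnS //.
  exact: leq_trans jn.
have tau_ge0 j : (j <= n)%N -> 0 <= tau j by move=> jn; exact: (tau_le 0).
have tauE v : exists2 i, (i <= n)%N & tau i = `|f v|.
  have : `|f v| \in s by rewrite inE mem_sort (map_f (fun v => `|f v|)) ?orbT // mem_enum.
  by move=> /(nthP 0)[i]; rewrite sz ltnS => ? ?; exists i.
pose D j := phi (tau j.+1) - phi (tau j).
have D_ge0 (j : 'I_n) : 0 <= D j by rewrite subr_ge0 hphi // tau_le.
have D_eq0 (j : 'I_n) : tau j.+1 = 0 -> D j = 0.
  move=> t0; have t1 : tau j = 0 by apply/le_anti; rewrite tau_ge0 1?ltnW // -t0 tau_le.
  by rewrite /D t0 t1 subrr.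
have phiE v : phi `|f v| = \sum_(j < n) D j * (tau j.+1 <= `|f v|)%R%:R.
  have [i il <-] := tauE v.
  (* Truncation at [tau i] removes the jumps above [|f v|], and the rest telescopes. *)
  pose G j := phi (Num.min (tau i) (tau j)).
  have -> : phi (tau i) = G n - G 0%N.
    by rewrite /G min_l ?tau_le // min_r ?tau_le // [tau 0%N]/= phi0 subr0.
  rewrite -(telescope_sumr G (leq0n n)) big_mkord; apply: eq_bigr => j _.
  rewrite /G /D; have [ij|ji] := leqP i j.
    have jn := ltn_ord j; have ij1 := leqW ij.
    rewrite (min_l (tau_le _ _ ij (ltnW jn))) (min_l (tau_le _ _ ij1 jn)).
    have [le1|] := leP (tau j.+1) (tau i); last by rewrite mulr0 subrr.
    have e1 : tau j.+1 = tau i by apply/le_anti; rewrite le1 (tau_le _ _ ij1 jn).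
    have e2 : tau j = tau i.
      by apply/le_anti; rewrite (tau_le _ _ ij (ltnW jn)) -e1 (tau_le _ _ (leqnSn j) jn).
    by rewrite e1 e2 subrr mul0r.
  rewrite (min_r (tau_le _ _ ji il)) (min_r (tau_le _ _ (ltnW ji) il)).
  by rewrite (tau_le _ _ ji il) mulr1.
have oddE v : odd_ext phi (f v) = \sum_(j < n) D j * cut_sign (tau j.+1) (f v).
  have t_gt0 (j : 'I_n) : D j = 0 \/ 0 < tau j.+1.
    have [/D_eq0|tn0] := eqVneq (tau j.+1) 0; first by left.
    by right; rewrite lt_neqAle eq_sym tn0 tau_ge0.
  have := phiE v; rewrite /odd_ext; case: (leP 0 (f v)) => fv.
    rewrite (ger0_norm fv) => ->; apply: eq_bigr => j _.
    have [->|tj] := t_gt0 j; first by rewrite !mul0r.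
    by rewrite /cut_sign [f v <= _]leNgt (_ : - tau j.+1 < f v) ?subr0 //; lra.
  rewrite (ltr0_norm fv) => ->; rewrite -sumrN; apply: eq_bigr => j _.
  have [->|tj] := t_gt0 j; first by rewrite !mul0r oppr0.
  rewrite /cut_sign [_ <= f v]leNgt (_ : f v < tau j.+1) ?sub0r /=; last lra.
  by rewrite lerNr mulrN.
under eq_bigr => v _ do rewrite phiE mulr_sumr.
rewrite exchange_big mulr_sumr /=.
apply: (@le_trans _ _ (\sum_(j < n) D j * ((\sum_u \sum_v w u v *
    `|cut_sign (tau j.+1) (f u) + cut_sign (tau j.+1) (f v)|) / 2))).
  apply: ler_sum => j _.
  have [/D_eq0 D0|tn0] := eqVneq (tau j.+1) 0.
    by rewrite D0 mul0r big1 ?mulr0 // => v _; rewrite mul0r mulr0.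
  under eq_bigr do rewrite mulrCA.
  rewrite -mulr_sumr mulrCA ler_wpM2l // cut_level //.
  by rewrite lt_neqAle eq_sym tn0 tau_ge0.
under [leLHS]eq_bigr do rewrite mulrA.
rewrite -mulr_suml ler_wpM2r ?invr_ge0 //.
under [leLHS]eq_bigr do rewrite mulr_sumr.
rewrite [leLHS]exchange_big ler_sum //= => u _.
under [leLHS]eq_bigr do rewrite mulr_sumr.
rewrite [leLHS]exchange_big ler_sum //= => v _.
under [leLHS]eq_bigr do rewrite mulrCA.
rewrite -[leLHS]mulr_sumr ler_wpM2l ?weight_ge0 // !oddE -big_split /=.
(* All levels give [cut_sign] sums of the same sign, so nothing is lost in moving the absolute value
   outside. *)
have key x y : 0 <= x + y -> \sum_(j < n) D j * `|cut_sign (tau j.+1) x + cut_sign (tau j.+1) y| <=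
    `|\sum_(j < n) (D j * cut_sign (tau j.+1) x + D j * cut_sign (tau j.+1) y)|.
  move=> xy; apply: le_trans (ler_norm _); apply: ler_sum => j _; rewrite -mulrDr.
  have [/D_eq0->|tn0] := eqVneq (tau j.+1) 0; first by rewrite !mul0r.
  by rewrite ger0_norm // cut_sign_add_ge0 // lt_neqAle eq_sym tn0 tau_ge0.
have [uv|/ltW uv] := leP 0 (f u + f v); first exact: key.
have := key (- f u) (- f v); rewrite -opprD oppr_ge0 uv => /(_ isT).
rewrite -[X in _ <= X -> _]normrN -sumrN.
under [X in X <= _ -> _]eq_bigr do rewrite !cut_signN -opprD normrN.
by under [X in _ <= `|X| -> _]eq_bigr do rewrite !cut_signN !mulrN -opprD opprK.
Qed.

End Coarea.

(** * Selecting functions of small energy *)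

Section Selection.
Variable R : realFieldType.

Lemma odd_ext_sqr (phi : R -> R) a : odd_ext phi a ^+ 2 = phi `|a| ^+ 2.
Proof.
rewrite /odd_ext; case: (leP 0 a) => a0; first by rewrite ger0_norm.
by rewrite ltr0_norm // sqrrN.
Qed.

Lemma odd_ext_mul_eq0 (phi psi : R -> R) a :
  phi `|a| * psi `|a| = 0 -> odd_ext phi a * odd_ext psi a = 0.
Proof.
rewrite /odd_ext; case: (leP 0 a) => a0; first by rewrite ger0_norm.
by rewrite ltr0_norm // mulrNN.
Qed.

(** Counting as in Markov's inequality: with fewer than [k] small indices, at least [k.+1] terms
    would each exceed [E / k.+1]. *)
Lemma many_small k (e : 'I_(k + k) -> R) E : 0 <= E -> (forall i, 0 <= e i) ->
  \sum_i e i <= E ->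
  exists2 s : 'I_k -> 'I_(k + k), injective s & forall i, k.+1%:R * e (s i) <= E.
Proof.
move=> E0 e0 sE; pose S := [set i | k.+1%:R * e i <= E].
have kS : (k <= #|S|)%N.
  rewrite leqNgt; apply/negP => Sk.
  have cS : (k.+1 <= #|~: S|)%N.
    by rewrite -(leq_add2l #|S|) cardsC card_ord addnS -addSn leq_add2r.
  have : k.+1%:R * E < k.+1%:R * E.
    apply: lt_le_trans (_ : k.+1%:R * \sum_(i in ~: S) e i <= _); last first.
      rewrite ler_wpM2l // (le_trans _ sE) // big_mkcond ler_sum // => i _.
      by case: ifP.
    have [i0 i0S] : exists i, i \in ~: S by apply/set0Pn; rewrite -card_gt0 (leq_trans _ cS).
    have big i : i \in ~: S -> E < k.+1%:R * e i by rewrite !inE -ltNge.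
    apply: (@le_lt_trans _ _ (\sum_(i in ~: S) E)).
      by rewrite sumr_const -[leRHS]mulr_natl ler_wpM2r // ler_nat.
    rewrite mulr_sumr (bigD1 i0) //= [ltRHS](bigD1 i0) //=.
    by rewrite ltr_leD ?big // ler_sum // => i /andP[/big/ltW].
  by rewrite ltxx.
exists (fun i => enum_val (widen_ord kS i)).
  by move=> i j /enum_val_inj /(congr1 val) /= /val_inj.
by move=> i; have := enum_valP (widen_ord kS i); rewrite inE.
Qed.

End Selection.

(** * The improved inequality for a fixed function *)

Section ImprovedCheeger.
Variables (R : rcfType) (n : nat) (w : 'I_n -> 'I_n -> R).
Hypothesis hw : is_weighted_graph w.
Hypothesis hdeg : forall v, 1 <= deg w v.
Variables (alpha : seq R) (halpha : is_sorted_spectrum w alpha) (k : nat).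
Hypothesis hk : (0 < k <= n)%N.
Local Notation al := alpha`_k.-1.
Hypothesis hal : 0 < al.
Variables (f : 'I_n -> R) (b : R).
Hypothesis b_le : forall t, 0 < t -> Lf f t :|: Rf f t != set0 ->
  b <= bip_ratio w (Lf f t) (Rf f t).
Local Notation E := (energy w f).

Section FixedThresholds.
Variables (t : nat -> R) (t_le : forall i, t i <= t i.+1) (t0 : t 0%N = 0).

Lemma sum_energy_tent m :
  \sum_(i < m) energy w (fun v => odd_ext (tent t i) (f v)) <= E.
Proof.
rewrite /energy -mulr_suml ler_wpM2r ?invr_ge0 // exchange_big ler_sum //= => u _.
rewrite exchange_big ler_sum //= => v _.
by rewrite -mulr_sumr ler_wpM2l ?weight_ge0 // odd_ext_tent_le.
Qed.

Lemma norm2_tent i :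
  norm2 w (fun v => odd_ext (tent t i) (f v)) = mass (deg w) (fun v => `|f v|) (t i) (t i.+1).
Proof. by apply: eq_bigr => v _; rewrite odd_ext_sqr. Qed.

(* Otherwise 2 k disjointly supported tents carry mass [C] each, hence k of
   them have a Rayleigh quotient below [al / 2]. *)
Lemma exists_light_interval C : 0 < C -> 2 * E <= k%:R * al * C ->
  exists i : 'I_(k + k), mass (deg w) (fun v => `|f v|) (t i) (t i.+1) != C.
Proof.
move=> C0 EC; apply/existsP; apply: contraT; rewrite negb_exists => /forallP mC.
have {}mC (i : 'I_(k + k)) : norm2 w (fun v => odd_ext (tent t i) (f v)) = C.
  by rewrite norm2_tent; apply/eqP; rewrite -[_ == _]negbK.
have [s s_inj s_small] := many_small (energy_ge0 hw f)
  (fun i : 'I_(k + k) => energy_ge0 hw (fun v => odd_ext (tent t i) (f v))) (sum_energy_tent _).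
have [||i] := disjoint_rayleigh_ge hw hdeg halpha hk (g := fun i v => odd_ext (tent t (s i)) (f v)).
- move=> i; apply/existsP; apply: contraT; rewrite negb_exists => /forallP g0.
  have := C0; rewrite -(mC (s i)) /norm2 big1 ?ltxx // => v _.
  by have := g0 v; rewrite negbK => /eqP->; rewrite expr0n mulr0.
- move=> i j v ij; apply: odd_ext_mul_eq0; apply: tent_mul_eq0 => //.
  by apply: contra ij => /eqP/val_inj/s_inj/eqP.
rewrite mC => ale; have := s_small i.
(* The contradiction: [k.+1%:R * al * C <= 2 * E <= k%:R * al * C], although [al * C] is
   positive. *)
have aC : 0 < al * C by rewrite mulr_gt0.
have k0 : 0 <= k%:R :> R by [].
by rewrite -natr1; set e := energy _ _ in ale *; nra.
Qed.

(** The coarea inequality for [tents_int], with the mass bounded below by [tents_int_ge]. The cross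
    terms between [f u + f v] and the tents are separated by Young's inequality with free parameter
    [lam]. *)
Lemma ratio_bound_of_thresholds m C lam : 0 <= b -> 0 < lam -> (forall v, `|f v| <= t m) ->
  (forall i, mass (deg w) (fun v => `|f v|) (t i) (t i.+1) <= C) ->
  b * norm2 w f <= m%:R * (2 * E + lam * E + 2 * m%:R * C / lam).
Proof.
move=> b0 lam0 fm mC.
have fb v : 0 <= `|f v| <= t m by rewrite normr_ge0 fm.
have lower : norm2 w f <= 4 * m%:R * \sum_v deg w v * tents_int t m `|f v|.
  rewrite mulr_sumr; apply: ler_sum => v _; rewrite [leRHS]mulrCA.
  rewrite ler_wpM2l ?(ltW (deg_gt0 hdeg v)) // -(real_normK (num_real (f v))).
  exact: tents_int_ge.
have sum_tents : \sum_v deg w v * tents t m `|f v| ^+ 2 <= m%:R * C.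
  under eq_bigr do rewrite tents_sqr // mulr_sumr.
  rewrite exchange_big; apply: (@le_trans _ _ (\sum_(i < m) C)).
    by apply: ler_sum => i _; exact: mC.
  by rewrite sumr_const card_ord mulr_natl.
have upper : (\sum_u \sum_v w u v * `|odd_ext (tents_int t m) (f u) + odd_ext (tents_int t m) (f v)|) / 2
    <= E / 2 + lam * E / 4 + m%:R * C / (2 * lam).
  pose d v := tents t m `|f v|.
  apply: (@le_trans _ _ ((\sum_u \sum_v (w u v * (f u + f v) ^+ 2 * (1 / 2 + lam / 4)
     + (w u v * d u ^+ 2 / (2 * lam) + w u v * d v ^+ 2 / (2 * lam)))) / 2)).
    rewrite ler_wpM2r ?invr_ge0 // ler_sum // => u _; rewrite ler_sum // => v _.
    rewrite [leRHS](_ : _ = w u v * ((f u + f v) ^+ 2 * (1 / 2 + lam / 4) +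
      (d u ^+ 2 + d v ^+ 2) / (2 * lam))); last by field; lra.
    rewrite ler_wpM2l ?weight_ge0 //.
    apply: le_trans (odd_ext_tents_int_le t_le t0 (fm u) (fm v)) _.
    rewrite -(real_normK (num_real (f u + f v))); set y := `|_|.
    rewrite -/(d u) -/(d v) -subr_ge0.
    (* Young's inequality, by completing the squares. *)
    rewrite [leRHS](_ : _ = ((lam * y / 2 - d u) ^+ 2 + (lam * y / 2 - d v) ^+ 2) / (2 * lam)).
      by rewrite divr_ge0 ?addr_ge0 ?sqr_ge0 // mulr_ge0 // ltW.
    by field; lra.
  have -> : \sum_u \sum_v (w u v * (f u + f v) ^+ 2 * (1 / 2 + lam / 4)
      + (w u v * d u ^+ 2 / (2 * lam) + w u v * d v ^+ 2 / (2 * lam))) =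
    (\sum_u \sum_v w u v * (f u + f v) ^+ 2) * (1 / 2 + lam / 4) +
    (\sum_u \sum_v w u v * d u ^+ 2 + \sum_u \sum_v w u v * d v ^+ 2) / (2 * lam).
    rewrite -big_split /= !mulr_suml -big_split; apply: eq_bigr => u _.
    rewrite -big_split /= !mulr_suml -big_split; apply: eq_bigr => v _ /=.
    by field; lra.
  rewrite (sum_weight_l hw (fun u => d u ^+ 2)) (sum_weight_r w (fun u => d u ^+ 2)).
  have -> : \sum_u \sum_v w u v * (f u + f v) ^+ 2 = 2 * E by rewrite /energy; field.
  have : (\sum_v deg w v * d v ^+ 2) / (2 * lam) <= m%:R * C / (2 * lam).
    by rewrite ler_wpM2r // invr_ge0 mulr_ge0 // ltW.
  by lra.
have co := coarea hw hdeg b_le (tents_int0 m t_le t0) (tents_int_homo m t_le).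
have m0 : 0 <= m%:R :> R by [].
apply: le_trans (ler_wpM2l b0 lower) _.
rewrite mulrCA; apply: le_trans (ler_wpM2l _ (le_trans co upper)) _; first by rewrite mulr_ge0.
rewrite le_eqVlt; apply/orP; left; apply/eqP; field; lra.
Qed.

End FixedThresholds.

Lemma ratio_tradeoff C lam : 0 <= b -> 0 < C -> 0 < lam -> 2 * E <= k%:R * al * C ->
  b * norm2 w f <= 2 * k%:R * (2 * E + lam * E + 4 * k%:R * C / lam).
Proof.
move=> b0 C0 lam0 EC; pose M := \sum_v `|f v|.
have fM v : `|f v| <= M by rewrite /M (bigD1 v) //= lerDl sumr_ge0.
have [t [t0 tP]] := threshold_sequence (deg w) (fun v => `|f v|) (ltW C0)
  (sumr_ge0 _ (fun v _ => normr_ge0 (f v)) : 0 <= M).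
have t_le i : t i <= t i.+1 by case: (tP i).
have mC i : mass (deg w) (fun v => `|f v|) (t i) (t i.+1) <= C by case: (tP i).
have [i mi] := exists_light_interval t_le t0 C0 EC.
(* The light interval has mass different from [C], so the greedy choice ended it at [M]. *)
have tM : M <= t (k + k)%N.
  have [_ _ _ [<-|e]] := tP i; first exact: threshold_le.
  by rewrite e eqxx in mi.
have := ratio_bound_of_thresholds t_le t0 b0 lam0 (fun v => le_trans (fM v) tM) mC.
rewrite natrD; set x := k%:R; rewrite (_ : (x + x) * _ = 2 * x * (2 * E + lam * E + 4 * x * C / lam)) //.
by field; lra.
Qed.

Lemma ratio_le : (exists v, f v != 0) ->
  b <= 16%:R * Num.sqrt 2%:R * k%:R * (E / norm2 w f) / Num.sqrt al.
Proof.
move=> f0; have F0 := norm2_gt0 hdeg f0; have E0 := energy_ge0 hw f.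
have [k0 _] := andP hk; have kR : 0 < k%:R :> R by rewrite ltr0n.
have q0 : 0 < Num.sqrt al by rewrite sqrtr_gt0.
have r0 : 0 < Num.sqrt 2%:R :> R by rewrite sqrtr_gt0.
have q2 : Num.sqrt al ^+ 2 = al by rewrite sqr_sqrtr // ltW.
have r2 : Num.sqrt 2%:R ^+ 2 = 2 :> R by rewrite sqr_sqrtr.
have [b0|b0] := ltP b 0.
  apply: le_trans (ltW b0) _; apply: divr_ge0 (ltW q0); apply: mulr_ge0; last by rewrite divr_ge0 // ltW.
  by rewrite !mulr_ge0 // ltW.
rewrite mulrA [X in _ <= X](_ : _ = 16 * Num.sqrt 2 * k%:R * E / Num.sqrt al / norm2 w f);
  last by rewrite mulrAC.
rewrite ler_pdivlMr //.
have al4 : al <= 4 := alpha_le4 hw hdeg halpha hk.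
set q := Num.sqrt al in q0 q2 *; set r := Num.sqrt 2 in r0 r2 *; set x := k%:R in kR *.
have [Egt|Ele] := ltP 0 E; last first.
  have Ez : E = 0 by apply/le_anti; rewrite Ele.
  rewrite Ez mulr0 mul0r leNgt; apply/negP => bF.
  (* For zero energy any [C > 0] is admissible; with [C = 1] this [lam] makes the bound [B / 2],
     contradicting [B > 0]. *)
  set B := b * _ in bF; have lam0 : 0 < 16 * x ^+ 2 / B by rewrite divr_gt0 // mulr_gt0 // exprn_gt0.
  have := ratio_tradeoff b0 ltr01 lam0; rewrite Ez !mulr0 !add0r -/B -/x mulr1.
  have -> : 2 * x * (4 * x * 1 / (16 * x ^+ 2 / B)) = B / 2 by field; rewrite !gt_eqF.
  by move=> /(_ (mulr_ge0 (ltW kR) (ltW hal))); lra.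
have C0 : 0 < 2 * E / (x * al) by apply: divr_gt0; apply: mulr_gt0.
have lam0 : 0 < 2 * r / q by apply: divr_gt0 => //; apply: mulr_gt0.
apply: le_trans (ratio_tradeoff b0 C0 lam0 _) _.
  by rewrite -/x [leRHS]mulrC divfK ?gt_eqF ?mulr_gt0.
rewrite -q2.
have rq : 2 / (r * q) = r / q by rewrite -{1}r2; field; rewrite !gt_eqF.
have -> : 2 * x * (2 * E + 2 * r / q * E + 4 * x * (2 * E / (x * q ^+ 2)) / (2 * r / q)) =
  4 * (x * E) * (1 + r / q + 2 / (r * q)) by field; rewrite !gt_eqF.
rewrite rq [leRHS](_ : _ = 4 * (x * E) * (4 * (r / q))); last by ring.
have xE : 0 <= 4 * (x * E) := mulr_ge0 (ler0n _ 4) (mulr_ge0 (ltW kR) E0).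
rewrite ler_wpM2l //.
(* Here [al <= 4] absorbs the constant term, giving the final factor 16. *)
have : 1 <= 2 * (r / q) by rewrite mulrA ler_pdivlMr // mul1r; nra.
by lra.
Qed.

End ImprovedCheeger.

(** * Eigenvectors as test functions, and the conclusion *)

Lemma exists_ground_state (R : rcfType) n (w : 'I_n -> 'I_n -> R) a :
  is_weighted_graph w -> (forall v, 1 <= deg w v) -> root (char_poly (Mmat w)) a ->
  exists2 f, (exists v, f v != 0) & energy w f = a * norm2 w f.
Proof.
move=> hw hdeg; rewrite -eigenvalue_root_char => /eigenvalueP[y yM y0].
(* Undoes [scaled_row], so the eigenvector equation becomes an identity between [energy] and
   [norm2]. *)
pose f v := y 0 v / Num.sqrt (deg w v).
have s0 v : Num.sqrt (deg w v) != 0 by rewrite gt_eqF // sqrtr_gt0 deg_gt0.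
have fy : scaled_row w f = y by apply/rowP => v; rewrite mxE divfK.
exists f; last by rewrite -!(scaled_row_form, scaled_row_norm) // fy yM -scalemxAl mxE.
apply/existsP; apply: contraNT y0; rewrite negb_exists => /forallP f0.
apply/eqP/rowP => v; have := f0 v; rewrite negbK mulf_eq0 invr_eq0 (negPf (s0 v)) orbF mxE.
by move/eqP.
Qed.

Theorem mainTheorem11 (R : rcfType) (n : nat) (w : 'I_n -> 'I_n -> R)
  (hw : is_weighted_graph w) (hdeg : forall v, 1 <= deg w v)
  (alpha : seq R) (halpha : is_sorted_spectrum w alpha)
  (k : nat) (hk1 : (1 <= k)%N) (hkn : (k <= n)%N) (hak : 0 < alpha`_k.-1) :
  (forall (f : 'I_n -> R) (b : R), (exists v, f v != 0) -> is_beta_f w f b ->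
     b <= 16%:R * Num.sqrt 2%:R * k%:R * RayleighPlus w f / Num.sqrt alpha`_k.-1)
  /\
  (forall b : R, is_betaG w b ->
     b <= 16%:R * Num.sqrt 2%:R * k%:R * alpha`_0 / Num.sqrt alpha`_k.-1).
Proof.
have hk : (0 < k <= n)%N by rewrite hk1.
split=> [f b f0 [_ b_le]|b [_ b_le]]; first exact: (ratio_le hw hdeg halpha hk hak b_le).
have [ss [_ cM]] := halpha.
have [f f0 Ef] : exists2 f, (exists v, f v != 0) & energy w f = alpha`_0 * norm2 w f.
  apply: exists_ground_state => //; rewrite cM root_prod_XsubC mem_nth // ss.
  exact: leq_trans hkn.
have -> : alpha`_0 = energy w f / norm2 w f by rewrite Ef mulfK // gt_eqF // norm2_gt0.
(* The level sets of [f] compete in the minimum defining [is_betaG]: for [t > 0] they are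
   disjoint. *)
apply: (ratio_le hw hdeg halpha hk hak) => // t t0; apply: b_le.
rewrite -setI_eq0; apply/eqP/setP => v; rewrite !inE.
by apply/negbTE/negP => /andP[]; lra.
Qed.
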